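(* The extended Weihrauch lattice of non-modest degrees embeds a copy of $\mathcal{P}(\omega)/\mathrm{Fin}$. That is, there is an order embedding of $(\mathcal{P}(\omega)/\mathrm{Fin},\subseteq^* )$ into the non-modest extended Weihrauch degrees, ordered by extended Weihrauch reducibility.
   Context: **Extended Weihrauch degrees** (in the sense of Bauer, over the natural numbers with partial computable functions). An extended Weihrauch predicate is a function $f:\omega\to\mathcal{P}(\mathcal{P}(\omega))$; its support is $\{n\in\omega : f(n)\neq\emptyset\}$. Given two such predicates $f,g$, say $f$ is (extended Weihrauch) reducible to $g$ if there are partial computable functions $\ell_1:\subseteq\omega\to\omega$ and $\ell_2:\subseteq\omega\times\omega\to\omega$ such that for every $n$ in the support of $f$: $\ell_1(n)$ is defined and lies in the support of $g$, and for every $\theta\in f(n)$ there is $\xi\in g(\ell_1(n))$ such that for every $m\in\xi$, $\ell_2(n,m)$ is defined and $\ell_2(n,m)\in\theta$. This is a preorder, and its equivalence classes are the extended Weihrauch degrees. A predicate $f$ is modest if $f(n)$ has at most one element for every $n$; a degree is modest if it contains a modest predicate, and non-modest otherwise. **$\mathcal{P}(\omega)/\mathrm{Fin}$.** $P\subseteq^*Q$ means $|P\setminus Q|<\infty$. $\mathcal{P}(\omega)/\mathrm{Fin}$ is the powerset of $\omega$ modulo the ideal $\mathrm{Fin}$ of finite sets, partially ordered by the relation induced by $\subseteq^*$. *)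

(* Defs.v *)
From HB Require Import structures.
From mathcomp Require Import all_boot all_order.
From mathcomp Require Import all_classical.

Set Implicit Arguments.
Unset Strict Implicit.
Unset Printing Implicit Defensive.

Import Order.TTheory.
Local Open Scope classical_set_scope.
Local Open Scope quotient_scope.

(* Programs for the mu-recursive functions of [k] arguments. *)
Inductive recfun : nat -> Type :=
| RZero k : recfun k
| RSucc : recfun 1
| RProj k : 'I_k -> recfun k
| RComp j k : recfun j -> ('I_j -> recfun k) -> recfun k
| RPrec k : recfun k -> recfun k.+2 -> recfun k.+1
| RMu k : recfun k.+1 -> recfun k.

(* [prec_eval f g n y]: the value at [n] of the primitive recursion with
   initial value given by [f] and step [g] is defined and equal to [y]. *)
Fixpoint prec_eval (f : nat -> Prop) (g : nat -> nat -> nat -> Prop)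
    (n : nat) : nat -> Prop :=
  if n is n'.+1 then fun y => exists2 z, prec_eval f g n' z & g n' z y else f.

(* [eval c v y]: the program [c] halts on the input [v], with output [y].
   In [RPrec f g] the recursion variable is the first argument, and the step
   [g] receives the recursion variable, the previous value, and the parameters.
   In [RMu f] the sought variable is the first argument of [f]. *)
Fixpoint eval k (c : recfun k) : k.-tuple nat -> nat -> Prop :=
  match c in recfun k return k.-tuple nat -> nat -> Prop with
  | RZero _ => fun _ y => y = 0
  | RSucc => fun v y => y = (thead v).+1
  | RProj _ i => fun v y => y = tnth v i
  | RComp j _ f g => fun v y => exists w : j.-tuple nat,
      (forall i, eval (g i) v (tnth w i)) /\ eval f w y
  | RPrec _ f g => fun v y =>
      prec_eval (eval f (behead_tuple v))
        (fun n z => eval g (cons_tuple n (cons_tuple z (behead_tuple v))))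
        (thead v) y
  | RMu _ f => fun v y =>
      eval f (cons_tuple y v) 0 /\
      forall z, z < y -> exists u, eval f (cons_tuple z v) u.+1
  end.

Lemma eval_functional k (c : recfun k) v y z :
  eval c v y -> eval c v z -> y = z.
Proof.
elim: c v y z => //=.
- by move=> ? v y z -> ->.
- by move=> v y z -> ->.
- by move=> k0 i v y z -> ->.
- move=> j k0 f If g Ig v y z [w [hw fw]] [w' [hw' fw']].
  have e : w = w' by apply: eq_from_tnth => i; apply: Ig (hw i) (hw' i).
  by rewrite -e in fw'; apply: If fw fw'.
- move=> k0 f If g Ig v y z; elim: (thead v) y z => [|n IH] y z /=; first exact: If.
  by move=> [u /IH hu gu] [u' /hu <-]; apply: Ig.
- move=> k0 f If v y z [fy hy] [fz hz]; case: (ltngtP y z) => // l.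
    by have [u /(If _ _ _ fy)] := hz _ l.
  by have [u /(If _ _ _ fz)] := hy _ l.
Qed.

(* A partial function is a function to [option nat], undefined at [v] when its
   value is [None]. *)
Definition partial_computable k (h : k.-tuple nat -> option nat) : Prop :=
  exists c : recfun k, forall v y, h v = Some y <-> eval c v y.

Definition partial_computable1 (l : nat -> option nat) : Prop :=
  partial_computable (fun v : 1.-tuple nat => l (tnth v ord0)).

Definition partial_computable2 (l : nat -> nat -> option nat) : Prop :=
  partial_computable
    (fun v : 2.-tuple nat => l (tnth v ord0) (tnth v ord_max)).

Lemma partial_computable1_id : partial_computable1 Some.
Proof. by exists (RProj ord0) => v y /=; split=> [[->]|->]. Qed.

Lemma partial_computable2_snd : partial_computable2 (fun _ m => Some m).
Proof. by exists (RProj ord_max) => v y /=; split=> [[->]|->]. Qed.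

Lemma partial_computable1_comp (l l' : nat -> option nat) :
  partial_computable1 l -> partial_computable1 l' ->
  partial_computable1 (fun n => obind l' (l n)).
Proof.
move=> [c hc] [c' hc']; exists (RComp c' (fun=> c)) => v y /=; split.
  case E: (l _) => [z|//] /= zy; exists [tuple z]; split; last exact/hc'.
  by move=> i; rewrite (ord1 i); apply/hc.
by move=> [w [/(_ ord0)/hc -> /hc']].
Qed.

Lemma partial_computable2_comp (l1 : nat -> option nat)
    (l2 l2' : nat -> nat -> option nat) :
  partial_computable1 l1 -> partial_computable2 l2 ->
  partial_computable2 l2' ->
  partial_computable2 (fun n m =>
    obind (fun k => obind (l2 n) (l2' k m)) (l1 n)).
Proof.
move=> [c1 h1] [c2 h2] [c2' h2'].
pose d1 : recfun 2 := RComp c1 (fun=> RProj ord0).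
pose d2 : recfun 2 :=
  RComp c2' (fun i => if i == ord0 then d1 else RProj ord_max).
exists (RComp c2 (fun i => if i == ord0 then RProj ord0 else d2)) => v y /=.
have e1 k : eval d1 v k <-> l1 (tnth v ord0) = Some k.
  split=> /=.
    move=> [w [/(_ ord0) e ew]].
    by apply/(h1 [tuple tnth v ord0]); rewrite -(_ : w = [tuple tnth v ord0])//;
       apply: eq_from_tnth => i; rewrite (ord1 i).
  by move=> /(h1 [tuple tnth v ord0]) ?; exists [tuple tnth v ord0]; split=> // i;
     rewrite (ord1 i).
have e2 k z : eval d1 v k ->
    l2' k (tnth v ord_max) = Some z -> eval d2 v z.
  move=> ek ez; exists [tuple k; tnth v ord_max]; split; last exact/h2'.
  by case=> [[|[|j]] i] //=; rewrite (tnth_nth 0).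
split.
  case E: (l1 _) => [k|//] /=; case E': (l2' _ _) => [z|//] /= zy.
  exists [tuple tnth v ord0; z]; split; last exact/h2.
  case=> [[|[|j]] i] //=; rewrite (tnth_nth 0) /=.
  by apply: (e2 k) => //; apply/e1.
move=> [w [hw /h2 wy]].
have := hw ord0; have := hw ord_max => /= -[u [hu /h2' uz]] w0.
have := hu ord0 => /= /e1 ->; have := hu ord_max => /= <-.
by rewrite /= uz /= -w0.
Qed.

Section PosetReflection.
Variables (disp : Order.disp_t) (T : preorderType disp).

Definition preorder_equiv : rel T := fun x y => (x <= y)%O && (y <= x)%O.

Lemma preorder_equiv_is_equiv : equiv_class_of preorder_equiv.
Proof.
split=> [x|x y|y x z]; first by rewrite /preorder_equiv lexx.
  by rewrite /preorder_equiv andbC.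
move=> /andP[xy yx] /andP[yz zy]; apply/andP; split.
  exact: le_trans xy yz.
exact: le_trans zy yx.
Qed.

Canonical preorder_equiv_equiv := EquivRelPack preorder_equiv_is_equiv.

Definition poset_reflection : Type := {eq_quot preorder_equiv}.
HB.instance Definition _ := Choice.on poset_reflection.
HB.instance Definition _ := EqQuotient.on poset_reflection.

Definition poset_reflection_le : rel poset_reflection :=
  fun a b => (repr a <= repr b)%O.

(* The order does not depend on the representatives. *)
Lemma poset_reflection_leE (x y : T) :
  poset_reflection_le (\pi_poset_reflection x) (\pi_poset_reflection y)
  = (x <= y)%O.
Proof.
rewrite /poset_reflection_le.
have /eqmodP/andP[xr rx] := reprK (\pi_poset_reflection x).
have /eqmodP/andP[yr ry] := reprK (\pi_poset_reflection y).
apply/idP/idP => h; first exact: le_trans rx (le_trans h yr).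
exact: le_trans xr (le_trans h ry).
Qed.

Lemma poset_reflection_le_refl : reflexive poset_reflection_le.
Proof. by move=> a; exact: lexx. Qed.

Lemma poset_reflection_le_anti : antisymmetric poset_reflection_le.
Proof.
elim/quotW=> x; elim/quotW=> y; rewrite !poset_reflection_leE => xy.
exact/eqmodP.
Qed.

Lemma poset_reflection_le_trans : transitive poset_reflection_le.
Proof. by move=> b a c; exact: le_trans. Qed.

HB.instance Definition _ := Order.Le_isPOrder.Build disp poset_reflection
  poset_reflection_le_refl poset_reflection_le_anti poset_reflection_le_trans.

Lemma pi_poset_reflection_le (x y : T) :
  (\pi_poset_reflection x <= \pi_poset_reflection y :> poset_reflection)%O
  = (x <= y)%O.
Proof. exact: poset_reflection_leE. Qed.

End PosetReflection.

Definition almost_subset (P Q : set nat) : Prop := finite_set (P `\` Q).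

(* An alias of [set nat], preordered by almost inclusion; [set nat] itself
   is already ordered by inclusion. *)
Definition omega_set : Type := set nat.
HB.instance Definition _ := Choice.on omega_set.

Definition almost_le : rel omega_set := fun P Q => `[< almost_subset P Q >].

Lemma almost_le_refl : reflexive almost_le.
Proof.
by move=> P; apply/asboolP; rewrite /almost_subset setDv; exact: finite_set0.
Qed.

Lemma almost_le_trans : transitive almost_le.
Proof.
move=> Q P R /asboolP PQ /asboolP QR; apply/asboolP.
apply: (sub_finite_set (B := (P `\` Q) `|` (Q `\` R))).
  by move=> n [Pn Rn]; have [Qn|Qn] := pselect (Q n); [right|left].
by rewrite finite_setU.
Qed.

Fact almost_display : Order.disp_t. Proof. exact: Order.Disp tt tt. Qed.

HB.instance Definition _ := Order.Le_isPreorder.Build almost_display omega_set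
  almost_le_refl almost_le_trans.

(* Two sets are identified exactly when their symmetric difference is finite. *)
Definition pomega_fin : porderType almost_display :=
  poset_reflection omega_set.

Definition ewpredicate : Type := nat -> set (set nat).
HB.instance Definition _ := Choice.on ewpredicate.

Definition support (f : ewpredicate) : set nat := [set n | f n !=set0].

Definition ew_reducible (f g : ewpredicate) : Prop :=
  exists (l1 : nat -> option nat) (l2 : nat -> nat -> option nat),
    [/\ partial_computable1 l1, partial_computable2 l2 &
      forall n, support f n ->
        exists k, [/\ l1 n = Some k, support g k &
          forall theta, f n theta ->
            exists2 xi, g k xi &
              forall m, xi m -> exists2 y, l2 n m = Some y & theta y]].

Definition ew_le : rel ewpredicate := fun f g => `[< ew_reducible f g >].

Lemma ew_le_refl : reflexive ew_le.
Proof.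
move=> f; apply/asboolP; exists Some, (fun _ m => Some m); split.
- exact: partial_computable1_id.
- exact: partial_computable2_snd.
- by move=> n fn; exists n; split=> // t ft; exists t => // m tm; exists m.
Qed.

Lemma ew_le_trans : transitive ew_le.
Proof.
move=> g f h /asboolP[l1 [l2 [c1 c2 H]]] /asboolP[k1 [k2 [d1 d2 K]]].
apply/asboolP; exists (fun n => obind k1 (l1 n)),
  (fun n m => obind (fun k => obind (l2 n) (k2 k m)) (l1 n)); split.
- exact: partial_computable1_comp.
- exact: partial_computable2_comp.
move=> n /H[k [-> gk H']] /=.
have [j [kj hj K']] := K _ gk; exists j; split=> // t /H'[xi gxi Hxi].
have [z hz Hz] := K' _ gxi; exists z => // m /Hz[y -> /Hxi[u ? ?]].
by exists u.
Qed.

Fact ew_display : Order.disp_t. Proof. exact: Order.Disp tt tt. Qed.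

HB.instance Definition _ := Order.Le_isPreorder.Build ew_display ewpredicate
  ew_le_refl ew_le_trans.

Definition ewdegree : porderType ew_display := poset_reflection ewpredicate.

Definition modest (f : ewpredicate) : Prop := forall n, is_subset1 (f n).

Definition modest_degree (d : ewdegree) : Prop :=
  exists2 f : ewpredicate, \pi_(poset_reflection ewpredicate) f = d & modest f.

Definition nonmodest_degree : Type :=
  {d : ewdegree | ~~ `[< modest_degree d >]}.
HB.instance Definition _ := SubChoice.on nonmodest_degree.
HB.instance Definition _ :=
  [SubChoice_isSubPOrder of nonmodest_degree by <: with ew_display].

(* Main.v *)
Require Import Defs.
From mathcomp Require Import all_boot all_order.
From mathcomp Require Import all_classical.

Set Implicit Arguments.
Unset Strict Implicit.
Unset Printing Implicit Defensive.

Import Order.TTheory.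
Local Open Scope classical_set_scope.
Local Open Scope quotient_scope.

(** Fix a function c whose values are mutually unpredictable: for every partial
    computable l and all but finitely many n, the value c n is not l(n, c k)
    for any k <> n, and not l(n, 0) or l(n, 1) either.  A set P is coded by the
    predicate that has one instance n.+1 for each n in P, whose only solution
    set is {c n}, together with the instance 0, whose two solution sets are {0}
    and {1}.

    The instance 0 makes the predicate non-modest.  A modest predicate that is
    equivalent to it would answer the instance 0 with a single solution set; a
    member of that set yields one number lying in both {0} and {1}, and it has
    a member because the coding predicate has no empty solution set
    ([not_modest_degree]).

    If P is almost contained in Q, an instance n.+1 with n in both sets is sent
    to itself, and the finitely many others are sent to the instance 0 and
    answered from a finite table, so only the computability of functions
    altered at finitely many arguments is needed ([coding_mono]).  Conversely,
    a reduction sends n.+1 with n in P but not in Q either to the instance 0 or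
    to some k.+1 with k <> n, hence computes c n from 0, from 1 or from c k,
    which happens for finitely many n only ([coding_reflect]).

    The function c exists for every countable family of functions in place of
    the partial computable ones ([exists_unpredictable_for]): it is built value
    by value, and a nonprincipal ultrafilter ensures that a value can be chosen
    so that the later ones are still free not to reveal it. *)

(** * Countably many partial computable functions *)

(** The arities are stored so that the tree of a program determines the type of
    the program as well, which lets injectivity be proved between programs of
    a priori different arities. *)
Fixpoint recfun_tree k (c : recfun k) : GenTree.tree nat :=
  match c with
  | RZero k => GenTree.Node 0 [:: GenTree.Leaf k]
  | RSucc => GenTree.Node 1 [::]
  | RProj k i => GenTree.Node 2 [:: GenTree.Leaf k; GenTree.Leaf (i : nat)]
  | RComp j k f g =>
      GenTree.Node 3 [:: GenTree.Leaf j, GenTree.Leaf k, recfun_tree f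
                       & [seq recfun_tree (g i) | i <- enum 'I_j]]
  | RPrec k f g =>
      GenTree.Node 4 [:: GenTree.Leaf k; recfun_tree f; recfun_tree g]
  | RMu k f => GenTree.Node 5 [:: GenTree.Leaf k; recfun_tree f]
  end.

Lemma Tagged_recfun_inj k (c c' : recfun k) :
  Tagged recfun c = Tagged recfun c' -> c = c'.
Proof. exact: eq_from_Tagged. Qed.

(** The two arities are independent because a case analysis on the second
    program is possible only at a variable arity; the equality of the programs
    has then to be stated between dependent pairs. *)
Lemma recfun_tree_inj_Tagged k (c : recfun k) k' (c' : recfun k') :
  recfun_tree c = recfun_tree c' -> Tagged recfun c = Tagged recfun c'.
Proof.
elim: c k' c' => [k1||k1 i|j k1 f If g Ig|k1 f If g Ig|k1 f If] k'
  [k2||k2 i2|j2 k2 f2 g2|k2 f2 g2|k2 f2] //=.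
- by case=> ->.
- by case=> e; case: _ / e i2 => i2 /ord_inj ->.
- case=> ej ek; case: _ / ej f2 g2 => f2 g2.
  case: _ / ek g2 => g2 /If/Tagged_recfun_inj <- eg.
  suff -> : g = g2 by [].
  apply/funext => i; apply/Tagged_recfun_inj/Ig.
  by move/eq_in_map: eg; apply; rewrite mem_enum.
- case=> e; case: _ / e f2 g2 => f2 g2.
  by move=> /If/Tagged_recfun_inj <- /Ig/Tagged_recfun_inj <-.
- by case=> e; case: _ / e f2 => f2 /If/Tagged_recfun_inj <-.
Qed.

Lemma recfun_tree_inj k : injective (@recfun_tree k).
Proof. by move=> c c' /recfun_tree_inj_Tagged/Tagged_recfun_inj. Qed.

Lemma partial_computable2_enum :
  exists Phi : nat -> nat -> nat -> option nat,
    forall l, partial_computable2 l -> exists e, Phi e = l.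
Proof.
pose computes (c : recfun 2) (l : nat -> nat -> option nat) :=
  forall v y, l (tnth v ord0) (tnth v ord_max) = Some y <-> eval c v y.
have /choice[Phi PhiP] e : exists f : nat -> nat -> option nat,
    forall c l, pickle (recfun_tree c) = e -> computes c l -> f = l.
  have [[c [l [ce cl]]]|no] :=
    pselect (exists c l, pickle (recfun_tree c) = e /\ computes c l).
  - exists l => c' l' ce' cl'.
    have cc' : c = c'.
      by apply: recfun_tree_inj; apply: (pcan_inj pickleK); rewrite ce ce'.
    apply/funext => n; apply/funext => m.
    have ll' y : l n m = Some y <-> l' n m = Some y.
      by have := cl [tuple n; m] y; have := cl' [tuple n; m] y; rewrite cc' => -> ->.
    case E: (l n m) => [y|]; first by apply/esym/ll'.
    by case E': (l' n m) => [y|//]; move/ll': E'; rewrite E.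
  - exists (fun _ _ => None) => c l ce cl.
    by exfalso; apply: no; exists c, l.
exists Phi => l [c cl]; exists (pickle (recfun_tree c)).
exact: PhiP cl.
Qed.

(** * Mutually unpredictable values *)

(** Dependent choice with access to all earlier values, without an invariant:
    [R] has to be satisfiable after every finite sequence. *)
Lemma history_choice (T : Type) (R : seq T -> T -> Prop) :
  (forall s, exists x, R s x) ->
  exists c : nat -> T, forall n, R (mkseq c n) (c n).
Proof.
move=> /choice[pick pickP].
pose chain n := iter n (fun s => rcons s (pick s)) [::].
exists (fun n => pick (chain n)) => n.
suff -> : mkseq (fun n => pick (chain n)) n = chain n by exact: pickP.
elim: n => // n IH; rewrite mkseqS IH //.
Qed.

Lemma filter_all_mem (T : Type) (I : eqType) (F : set_system T) {FF : Filter F}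
    (s : seq I) (A : I -> set T) :
  (forall i, i \in s -> F (A i)) ->
  F [set x | forall i, i \in s -> A i x].
Proof.
elim: s => [|j s IH] FA; first by apply: filterE.
have Fj := FA j (mem_head j s).
have {}IH := IH (fun i si => FA i (@mem_behead _ (j :: s) i si)).
apply: filterS2 Fj IH => x Ajx sx i.
by rewrite inE => /predU1P[->|/sx].
Qed.

(** Keeping c n out of reach of the earlier values is a finite restriction; the
    difficulty is that later values must not reveal c n either.  Along a
    nonprincipal ultrafilter U, a function m |-> Phi e n m is constantly equal
    to v on a set of U for at most one v, its limit.  If c n is not this limit,
    then the m that do not reveal c n through Phi e n form a set of U.  So c n
    is chosen away from the limits of its own index, and inside the sets of U
    imposed by the earlier values: finitely many sets of U have a common
    element. *)
Lemma exists_unpredictable_for (Phi : nat -> nat -> nat -> option nat)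
    (hints : seq nat) :
  exists c : nat -> nat, forall e n, e <= n ->
  (forall m, m \in hints -> Phi e n m <> Some (c n)) /\
  (forall k, k != n -> Phi e n (c k) <> Some (c n)).
Proof.
have [U [UU subU]] := ultraFilterLemma eventually_filter.
pose limit e n v := U [set m | Phi e n m = Some v].
have U_neq v : U [set x | x != v].
  by apply: subU; exists v.+1 => // x /= vx; rewrite gtn_eqF.
have U_nlimit e n : U [set x | ~ limit e n x].
  have [[v ev]|no] := pselect (exists v, limit e n v); last first.
    by apply: filterE => x lx; apply: no; exists x.
  apply: filterS (U_neq v) => x /= /eqP xv lx; apply: xv.
  have [m [] /= -> []//] := filter_ex (filterI lx ev).
(* The third condition is guarded by the first one at the earlier stages, which
   makes it satisfiable after an arbitrary sequence of values. *)
have [|c cP] := @history_choice nat (fun s x => let n := size s in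
    [/\ forall e, e \in iota 0 n.+1 -> ~ limit e n x,
        forall e, e \in iota 0 n.+1 ->
          forall m, m \in hints ++ s -> Phi e n m <> Some x &
        forall k, k \in iota 0 n -> forall e, e \in iota 0 k.+1 ->
          ~ limit e k (nth 0 s k) -> Phi e k x <> Some (nth 0 s k)]).
  move=> s; set n := size s.
  have U1 : U [set x | forall e, e \in iota 0 n.+1 -> ~ limit e n x].
    by apply: filter_all_mem => e _; exact: U_nlimit.
  have U2 : U [set x | forall e, e \in iota 0 n.+1 ->
      forall m, m \in hints ++ s -> Phi e n m <> Some x].
    apply: filter_all_mem => e _; apply: filter_all_mem => m _.
    case: (Phi e n m) => [v|]; last exact: filterE.
    by apply: filterS (U_neq v) => x /= /eqP xv [] /esym.
  have U3 : U [set x | forall k, k \in iota 0 n -> forall e, e \in iota 0 k.+1 ->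
      ~ limit e k (nth 0 s k) -> Phi e k x <> Some (nth 0 s k)].
    apply: filter_all_mem => k _; apply: filter_all_mem => e _.
    have [l|nl] := in_ultra_setVsetC [set x | Phi e k x = Some (nth 0 s k)] UU.
      by apply: filterE.
    by apply: filterS nl.
  by have [x [[x1 x2] x3]] := filter_ex (filterI (filterI U1 U2) U3); exists x.
exists c => e n en; have := cP n; rewrite /= size_mkseq => -[c1 c2 c3].
have en' : e \in iota 0 n.+1 by rewrite mem_iota.
split=> [m mh|k]; first by apply: c2 => //; rewrite mem_cat mh.
(* The later of the two values is the one whose choice took care of the pair. *)
case: ltngtP => // [kn|nk] _.
  by apply: c2 => //; rewrite mem_cat map_f ?orbT// mem_iota.
have := cP k; rewrite /= size_mkseq => -[_ _ /(_ n)].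
rewrite nth_mkseq // mem_iota => /(_ nk e en'); apply.
exact: c1.
Qed.

(** The first argument of [l] is shifted because c n is coded at the instance
    n.+1. *)
Definition unpredictable (hints : seq nat) (c : nat -> nat) : Prop :=
  forall l, partial_computable2 l -> exists N, forall n, N <= n ->
    (forall m, m \in hints -> l n.+1 m <> Some (c n)) /\
    (forall k, k != n -> l n.+1 (c k) <> Some (c n)).

Lemma exists_unpredictable hints : exists c, unpredictable hints c.
Proof.
have [Phi PhiP] := partial_computable2_enum.
have [c cP] := exists_unpredictable_for (fun e n => Phi e n.+1) hints.
by exists c => l /PhiP[e <-]; exists e => n /cP.
Qed.

(** * Computability of finite tables *)

Definition total_computable k (h : k.-tuple nat -> nat) : Prop :=
  partial_computable (fun v => Some (h v)).

Lemma eq_total_computable k (h h' : k.-tuple nat -> nat) :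
  h =1 h' -> total_computable h -> total_computable h'.
Proof. by move=> /funext ->. Qed.

Lemma total_computable_proj k (i : 'I_k) : total_computable (fun v => tnth v i).
Proof. by exists (RProj i) => v y /=; split=> [[->]|->]. Qed.

Lemma total_computable_succ k (h : k.-tuple nat -> nat) :
  total_computable h -> total_computable (fun v => (h v).+1).
Proof.
move=> [c hc]; exists (RComp RSucc (fun=> c)) => v y /=; split.
  by move=> [<-]; exists [tuple h v]; split=> // i; rewrite (ord1 i); apply/hc.
by move=> [w [/(_ ord0)/hc [->] ->]].
Qed.

Lemma total_computable_const k b : total_computable (fun _ : k.-tuple nat => b).
Proof.
elim: b => [|b]; last exact: total_computable_succ.
by exists (RZero k) => v y /=; split=> [[->]|->].
Qed.

(** A case distinction on the first argument is a primitive recursion whose step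
    ignores the recursive value. *)
Lemma total_computable_cases k (h : nat -> k.-tuple nat -> nat) :
  total_computable (h 0) ->
  total_computable (fun v : k.+1.-tuple nat => h (thead v).+1 (behead_tuple v)) ->
  total_computable (fun v : k.+1.-tuple nat => h (thead v) (behead_tuple v)).
Proof.
move=> [c0 h0] [cS hS].
(* Runs [cS] on all arguments but the one at position 1, the recursive value. *)
pose skip : recfun k.+2 :=
  RComp cS (fun i => RProj (if i == ord0 then ord0 else lift ord0 i)).
have skipP n z (v : k.-tuple nat) y :
    eval skip (cons_tuple n (cons_tuple z v)) y <-> h n.+1 v = y.
  have nv : behead_tuple (cons_tuple n v) = v by exact: val_inj.
  have -> : h n.+1 v = y <-> eval cS (cons_tuple n v) y.
    by rewrite -hS theadE nv; split=> [->|[]].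
  split=> /= [[w [wP ew]]|ev]; last first.
    exists (cons_tuple n v); split=> // i; case: (unliftP ord0 i) => [j ->|->//].
    by rewrite eq_sym eq_liftF !(tnth_nth 0).
  suff <- : w = cons_tuple n v by [].
  apply: eq_from_tnth => i; rewrite wP; case: (unliftP ord0 i) => [j ->|->//].
  by rewrite eq_sym eq_liftF !(tnth_nth 0).
exists (RPrec c0 skip) => v y /=.
elim: (thead v) y => [|n IH] y /=; first exact: h0.
split=> [[<-]|[z _ /skipP <-//]].
by exists (h n (behead_tuple v)); [exact/IH|exact/skipP].
Qed.

(** The programs for [h n] with n < N need not be found effectively from n: they
    are hardwired in N nested case distinctions. *)
Lemma total_computable_tail k N (h : nat -> k.-tuple nat -> nat) :
  (forall n, total_computable (h n)) ->
  total_computable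
    (fun v : k.+1.-tuple nat => h (N + thead v) (behead_tuple v)) ->
  total_computable (fun v : k.+1.-tuple nat => h (thead v) (behead_tuple v)).
Proof.
elim: N h => [//|N IH] h hn hN.
apply: total_computable_cases => //.
by apply: (IH (fun n => h n.+1)).
Qed.

Lemma partial_computable1_eventually_id N (h : nat -> nat) :
  (forall n, N <= n -> h n = n) -> partial_computable1 (Some \o h).
Proof.
move=> hN.
apply: (@total_computable_tail 0 N (fun n _ => h n)) => [n|].
  exact: total_computable_const.
apply: (@eq_total_computable _ (fun v => N + tnth v ord0)) => [v|].
  by rewrite hN ?leq_addr.
elim: N {hN} => [|N]; first exact: total_computable_proj.
exact: total_computable_succ.
Qed.

Lemma partial_computable2_eventually_snd N (h : nat -> nat -> nat) :
  (forall n, partial_computable1 (Some \o h n)) ->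
  (forall n m, N <= n -> h n m = m) ->
  partial_computable2 (fun n m => Some (h n m)).
Proof.
move=> hn hN.
have maxE (v : 2.-tuple nat) : tnth v ord_max = tnth (behead_tuple v) ord0.
  by case/tupleP: v => x v; case/tupleP: v => y v; rewrite !(tnth_nth 0).
rewrite /partial_computable2; under eq_fun do rewrite maxE.
apply: (@total_computable_tail 1 N (fun n w => h n (tnth w ord0))) => [n|].
  exact: hn.
apply: (@eq_total_computable _ (fun v => tnth v ord_max)) => [v|].
  by rewrite hN ?leq_addr // maxE.
exact: total_computable_proj.
Qed.

(** * The coding predicates *)

Definition coding (c : nat -> nat) (P : omega_set) : ewpredicate :=
  fun k => if k is n.+1 then [set t | P n /\ t = [set c n]]
           else [set [set 0]; [set 1]].

Lemma coding_nonempty c P k t : coding c P k t -> t !=set0.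
Proof.
by case: k => [[]->|n [_ ->]] /=; [exists 0|exists 1|exists (c n)].
Qed.

Lemma coding_mono c P Q :
  almost_subset P Q -> ew_reducible (coding c P) (coding c Q).
Proof.
move=> /finite_seqP[s sPQ].
(* On the finite set [s] of exceptions the answer comes from a table, but the
   instance must still be sent into the support of the target: 0 always is. *)
pose l1 k := if k is n.+1 then if n \in s then 0 else n.+1 else 0.
pose l2 k m := if k is n.+1 then if n \in s then c n else m else m.
pose N := (\max_(n <- s) n).+2.
have Ns n : N <= n.+1 -> n \notin s.
  apply: contraL => ns; rewrite -ltnNge !ltnS; exact: (@leq_bigmax_seq _ s xpredT id).
exists (Some \o l1), (fun n m => Some (l2 n m)); split.
- by apply: (@partial_computable1_eventually_id N) => -[//|n] /Ns/negbTE /= ->.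
- apply: (@partial_computable2_eventually_snd N); last first.
    by move=> [//|n] m /Ns/negbTE /= ->.
  move=> [|n] /=; first exact: partial_computable1_id.
  rewrite /comp /=; case: (n \in s); last exact: partial_computable1_id.
  exact: total_computable_const.
case=> [|n] [t tP].
  exists 0; split=> //; first by exists t.
  by move=> theta ?; exists theta => // m; exists m.
have [Pn _] := tP; rewrite /= ; case: ifPn => ns.
  exists 0; split=> //; first by exists [set 0]; left.
  move=> theta [_ ->]; exists [set 0]; first by left.
  by move=> m _; exists (c n).
have Qn : Q n.
  apply: contrapT => nQ; move/negP: ns; apply.
  by suff : [set` s] n by []; rewrite -sPQ.
exists n.+1; split=> //; first by exists [set c n].
by move=> theta [_ ->]; exists [set c n] => // m ->; exists (c n).
Qed.

Lemma coding_reflect c P Q : unpredictable [:: 0; 1] c ->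
  ew_reducible (coding c P) (coding c Q) -> almost_subset P Q.
Proof.
move=> cU [l1 [l2 [_ /cU[N NP] red]]].
apply: sub_finite_set (finite_II N) => n [Pn nQn] /=; rewrite ltnNge.
apply/negP => /NP[hintsP othersP].
have [|[|k] [_ [xi0 xi0P] /(_ [set c n])]] := red n.+1.
- by exists [set c n].
- move=> []// xi [->|->] /(_ _ erefl)[y ly yc].
    by apply: (hintsP 0); rewrite // ly yc.
  by apply: (hintsP 1); rewrite // ly yc.
- move=> []// xi [Qk ->] /(_ _ erefl)[y ly yc].
  apply: (othersP k); last by rewrite ly yc.
  by apply: contra_notN nQn => /eqP <-.
Qed.

(** Solutions of an equivalent modest g would be common to all solution sets of
    f at n, since g offers the same solution set for each of them.  The
    reduction of g to f rules out that this solution set is empty, in which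
    case no solution would be produced at all. *)
Lemma not_modest_degree (f : ewpredicate) n :
  f n !=set0 -> (forall k t, f k t -> t !=set0) ->
  (forall y, exists2 t, f n t & ~ t y) ->
  ~ modest_degree (\pi_(poset_reflection ewpredicate) f).
Proof.
move=> fn f0 fcap [g /eqmodP/andP[gf fg] g1].
move: gf fg => /asboolP[l1 [l2 [_ _ gf]]] /asboolP[k1 [k2 [_ _ fg]]].
have [k [_ [xi gxi] fgk]] := fg n fn.
(* An empty [xi] would be served only by an empty solution set of [f]. *)
have [m xim] : xi !=set0.
  have [j [_ _ /(_ _ gxi)[t ft txi]]] := gf k (ex_intro _ xi gxi).
  have [x tx] := f0 _ _ ft.
  by have [y _ xiy] := txi x tx; exists y.
have common t : f n t -> exists2 y, k2 n m = Some y & t y.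
  by move=> /fgk[xi' gxi'] ; apply; rewrite (g1 k _ _ gxi' gxi).
have [t0 ft0] := fn; have [y ky _] := common _ ft0.
have [t ft] := fcap y; apply.
by have [y'] := common t ft; rewrite ky => -[<-].
Qed.

Lemma coding_not_modest c P :
  ~ modest_degree (\pi_(poset_reflection ewpredicate) (coding c P)).
Proof.
apply: (@not_modest_degree _ 0).
- by exists [set 0]; left.
- exact: coding_nonempty.
case=> [|y]; first by exists [set 1]; [right|].
by exists [set 0]; [left|].
Qed.

Theorem theorem4p1 :
  exists e : pomega_fin -> nonmodest_degree,
    {mono e : x y / (x <= y)%O}.
Proof.
have [c cU] := exists_unpredictable [:: 0; 1].
have nm (P : omega_set) : ~~ `[< modest_degree
    (\pi_(poset_reflection ewpredicate) (coding c P)) >].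
  by apply/asboolPn; exact: coding_not_modest.
pose e (x : pomega_fin) : nonmodest_degree :=
  Sub (_ : ewdegree) (nm (repr x)).
exists e => x y.
rewrite leEsub /= pi_poset_reflection_le.
by apply/asboolP/asboolP; [exact: coding_reflect|exact: coding_mono].
Qed.
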